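(* For the $n$th supertriangle $T_n$: 1. $\mathrm{Z}_{(0)}(T_n)=\mathrm{Z}_{(1)}(T_n)=n$; 2. $\mathrm{Z}_{(2)}(T_n)\le \mathrm{Z}_{(3)}(T_n)\le 2n-1$; and 3. $\mathrm{Z}_{(4)}(T_n)=\mathrm{Z}_{(5)}(T_n)=3n-3$.
   Context: The $n$th supertriangle $T_n$ is the equilateral triangular grid graph with $n$ vertices on each side; concretely, its vertices are the triples $(a,b,c)$ of nonnegative integers with $a+b+c=n-1$, and two distinct vertices are adjacent if and only if one is obtained from the other by adding $1$ to one coordinate and subtracting $1$ from another. Zero forcing color change rule: a blue vertex $u$ may force (color blue) a white vertex $v$ if $v$ is the only white neighbor of $u$. A leak is a vertex that is not allowed to perform a force. A set $B\subseteq V(G)$ is an $\ell$-leaky forcing set of a graph $G$ if, whenever any $\ell$ vertices of $G$ are chosen to be leaks (after $B$ has been specified), starting with exactly $B$ blue (all others white) and iteratively applying the color change rule, with leaks not allowed to force, eventually colors all of $V(G)$ blue. $\mathrm{Z}_{(\ell)}(G)$ is the minimum size of an $\ell$-leaky forcing set of $G$.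
   Formalization: Part 3 is stated for n ≥ 2, since T_1 is a single isolated vertex with number 1 while 3n−3 = 0; when ℓ exceeds the number of vertices, all vertices are taken to be leaks (otherwise part 3 would fail at n = 2). *)

(* Defs.v *)
From mathcomp Require Import all_boot.

Set Implicit Arguments.
Unset Strict Implicit.
Unset Printing Implicit Defensive.

(* Zero forcing on a finite graph with vertex type T and adjacency relation e;
   a set of vertices is identified with the colouring in which exactly its
   elements are blue. *)
Section LeakyForcing.

Variables (T : finType) (e : rel T).
Implicit Types (L B : {set T}) (u v : T) (l : nat).

Definition may_force L B u v : bool :=
  [&& u \in B, u \notin L, v \notin B, e u v &
      [forall w, e u w && (w \notin B) ==> (w == v)]].

Definition force_step L : rel {set T} :=
  fun B B' => [exists u, exists v, may_force L B u v && (B' == v |: B)].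

(* When l exceeds the number of vertices, l distinct leaks do not exist and
   all vertices are taken to be leaks (rather than letting the condition hold
   vacuously); otherwise L ranges over the sets of exactly l vertices. *)
Definition leaky_forcing l B : bool :=
  [forall L : {set T},
     (#|L| == minn l #|T|) ==> connect (force_step L) B [set: T]].

Lemma leaky_forcing_setT l : leaky_forcing l [set: T].
Proof. by apply/forallP => L; rewrite connect0 implybT. Qed.

(* The default value setT of the arg min is a leaky forcing set by
   leaky_forcing_setT, so this is a genuine minimum. *)
Definition leaky_forcing_number l : nat :=
  #|[arg min_(B < [set: T] | leaky_forcing l B) #|B|]|.

Lemma leaky_forcing_numberP l :
  (exists2 B, leaky_forcing l B & #|B| = leaky_forcing_number l) /\
  (forall B, leaky_forcing l B -> leaky_forcing_number l <= #|B|).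
Proof.
rewrite /leaky_forcing_number; case: arg_minnP => [|B lfB minB].
  exact: leaky_forcing_setT.
by split; first exists B.
Qed.

End LeakyForcing.

(* A triple (a, b, c) is a function on 'I_3; the bound by n on the coordinates
   follows from the sum condition and only serves to make the type finite. *)
Definition supertriangle (n : nat) : finType :=
  {f : {ffun 'I_3 -> 'I_n} | \sum_(i < 3) f i == n.-1}.

Definition supertriangle_adj (n : nat) : rel (supertriangle n) :=
  fun x y => [exists i : 'I_3, exists j : 'I_3,
    [&& i != j, val y i == (val x i).+1 :> nat,
        (val y j).+1 == val x j :> nat &
        [forall k, (k != i) && (k != j) ==> (val y k == val x k)]]].

Lemma supertriangle_adj_sym n : symmetric (@supertriangle_adj n).
Proof.
have sub x y : @supertriangle_adj n x y -> supertriangle_adj y x.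
  case/existsP=> i /existsP[j /and4P[ij yi yj /forallP yk]].
  apply/existsP; exists j; apply/existsP; exists i.
  rewrite eq_sym ij eq_sym yj eq_sym yi /=; apply/forallP => k.
  by rewrite andbC eq_sym [_ == val y k]eq_sym; move: (yk k); rewrite eq_sym.
by move=> x y; apply/idP/idP; apply: sub.
Qed.

Lemma supertriangle_adj_irrefl n : irreflexive (@supertriangle_adj n).
Proof.
move=> x; apply/negbTE/negP => /existsP[i /existsP[j /and4P[_ /eqP xi _ _]]].
by move: (ltnn (val x i)); rewrite {2}xi ltnSn.
Qed.

(* Z_(l)(T_n) *)
Definition Zleaky (l n : nat) : nat :=
  leaky_forcing_number (@supertriangle_adj n) l.

(* Main.v *)
Require Import Defs.
From mathcomp Require Import all_boot.
From mathcomp Require Import zify.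

Set Implicit Arguments.
Unset Strict Implicit.
Unset Printing Implicit Defensive.

(** The upward unit triangles of T_n partition its edges into cliques. Each force
    completes the colouring of at least one of them, and there are n fewer upward
    triangles than vertices, so a forcing set has at least n elements, whatever
    the leaks.

    The process stalls only if every blue vertex with a unique white neighbour is
    a leak. Now let W be a nonempty white set avoiding the k sides x_j = 0,
    j in J. For j in J and i <> j, take w in W maximising x_i and, among these,
    minimising x_j; then w + e_i - e_j is blue and w is its only white neighbour.
    The 2k vertices obtained in this way are distinct, so the union of k sides
    resists 2k - 1 leaks.

    Finally, boundary vertices have degree at most 4, so four leaks suffice to
    prevent one from ever being forced. *)

(** * Padding of finite sets and invariants along paths *)

(** Leak sets have exactly [minn l #|T|] elements; padding to that size lets a smaller set of wanted
    leaks be used. *)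
Lemma superset_of_card (T : finType) (A : {set T}) (m : nat) :
  #|A| <= m <= #|T| -> exists2 A' : {set T}, A \subset A' & #|A'| = m.
Proof.
case/andP=> leAm lemT; pose s := take (m - #|A|) (enum (~: A)).
have sC x : x \in s -> x \notin A.
  by move/mem_take; rewrite mem_enum inE.
exists (A :|: [set x in s]); first exact: subsetUl.
rewrite cardsU; have -> : A :&: [set x in s] = set0.
  apply/setP=> x; rewrite !inE; by apply/negP=> /andP[xA /sC]; rewrite xA.
rewrite cards0 subn0 cardsE (card_uniqP _) ?take_uniq ?enum_uniq //.
rewrite size_takel ?subnKC // -cardE; have := cardsC A; lia.
Qed.

Lemma connect_ind (R : finType) (r : rel R) (P : R -> Prop) (x y : R) :
  (forall z t, r z t -> P z -> P t) -> connect r x y -> P x -> P y.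
Proof.
move=> rP /connectP[p + ->]; elim: p x => [//|z p IHp] x /= /andP[xz zp] Px.
exact: IHp zp (rP _ _ xz Px).
Qed.

(** * Criteria and bounds for leaky forcing on an arbitrary graph *)

Section LeakyForcing.

Variables (T : finType) (e : rel T).
Implicit Types (L B S : {set T}) (u v w : T) (l : nat).

Lemma force_stepP L S S' :
  reflect (exists2 uv, may_force e L S uv.1 uv.2 & S' = uv.2 |: S)
          (force_step e L S S').
Proof.
apply: (iffP existsP) => [[u /existsP[v /andP[uv /eqP->]]]|[[u v] /= uv ->]].
  by exists (u, v).
by exists u; apply/existsP; exists v; rewrite uv eqxx.
Qed.

(** Extra leaks only remove forces: whatever is reached under an enlarged leak set [L'] is reached
    under [L]. *)
Lemma leaky_forcing_le l l' B : l <= l' ->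
  leaky_forcing e l' B -> leaky_forcing e l B.
Proof.
move=> le_ll' /forallP forceB; apply/forallP => L; apply/implyP => /eqP cardL.
have [|L' sLL' cardL'] := @superset_of_card T L (minn l' #|T|).
  by rewrite cardL; lia.
have := forceB L'; rewrite cardL' eqxx /=; apply: connect_sub => S S'.
case/force_stepP=> [[u v] /= /and5P[uS uL' vS euv uv]] ->.
apply/connect1/force_stepP; exists (u, v) => //=.
by apply/and5P; split=> //; apply: contra uL'; apply: subsetP.
Qed.

Lemma leaky_forcing_number_le l l' : l <= l' ->
  leaky_forcing_number e l <= leaky_forcing_number e l'.
Proof.
move=> le_ll'; have [[B forceB <-] _] := leaky_forcing_numberP e l'.
by have [_] := leaky_forcing_numberP e l; apply; apply: leaky_forcing_le forceB.
Qed.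

Definition sole_white_neighbor S u v :=
  [&& v \notin S, e u v & [forall w, e u w && (w \notin S) ==> (w == v)]].

Definition ready S := [set u in S | [exists v, sole_white_neighbor S u v]].

(** Take a largest reachable colouring [S]. If it were not full, the leaks could not cover
    [ready S], and a force by an uncovered vertex would enlarge [S]. *)
Lemma leaky_forcing_ready l B :
  (forall S, B \subset S -> S != setT -> l < #|ready S|) -> leaky_forcing e l B.
Proof.
move=> readyB; apply/forallP => L; apply/implyP => /eqP cardL.
case: (@arg_maxnP _ B (connect (force_step e L) B) (fun S => #|S|)) => //.
move=> S conS maxS; have [<-//|SnT] := eqVneq S setT.
have sBS : B \subset S.
  apply: (connect_ind (P := fun S => B \subset S) _ conS) => // S1 S2.
  by case/force_stepP=> uv _ -> sB; apply: subset_trans sB (subsetUr _ _).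
have : ~~ (ready S \subset L).
  apply/negP=> /subset_leq_card; have := readyB _ sBS SnT; lia.
case/subsetPn=> u; rewrite inE => /andP[uS /existsP[v /and3P[vS euv uv]]] uL.
have /maxS /= : connect (force_step e L) B (v |: S).
  apply: connect_trans conS (connect1 _).
  by apply/force_stepP; exists (u, v) => //; apply/and5P.
by rewrite cardsU1 vS add1n ltnn.
Qed.

(** Once all neighbours of [v] are leaks, nothing can force [v], so it must be blue from the
    start. *)
Lemma leaky_forcing_low_degree l B v :
  #|[set u | e u v]| <= l -> leaky_forcing e l B -> v \in B.
Proof.
move=> degv /forallP forceB.
have [|L sNL cardL] := @superset_of_card T [set u | e u v] (minn l #|T|).
  by rewrite leq_min degv max_card geq_minr.
have := forceB L; rewrite cardL eqxx /= => conB; apply: contraT => vB.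
have : v \notin [set: T]; last by rewrite inE.
apply: (connect_ind (P := fun S => v \notin S) _ conB) => // S S'.
case/force_stepP=> [[u w] /= /and5P[_ uL _ euw _]] -> vS.
rewrite !inE negb_or vS andbT; apply: contraNneq uL => vw.
by apply: (subsetP sNL); rewrite inE vw.
Qed.

(* A force along an edge of a clique K completes the colouring of K, so distinct
   forces complete distinct cliques of an edge clique cover. *)
Lemma leaky_forcing_clique_cover l B (C : {set {set T}}) :
    (forall K u v, K \in C -> u \in K -> v \in K -> u != v -> e u v) ->
    (forall u v, e u v -> exists2 K, K \in C & (u \in K) && (v \in K)) ->
  leaky_forcing e l B -> #|T| <= #|B| + #|C|.
Proof.
move=> cliqueC coverC /forallP forceB.
have [|L _ cardL] := @superset_of_card T set0 (minn l #|T|).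
  by rewrite cards0 geq_minr.
have := forceB L; rewrite cardL eqxx /= => conB.
pose full S := [set K in C | K \subset S].
have : #|[set: T]| + #|full B| <= #|B| + #|full [set: T]|.
  apply: (connect_ind
    (P := fun S => #|S| + #|full B| <= #|B| + #|full S|) _ conB) => // S S'.
  case/force_stepP=> [[u v] /= /and5P[uS _ vS euv /forallP uv]] -> IH.
  suff : #|full S| < #|full (v |: S)| by move: IH; rewrite /= cardsU1 vS; lia.
  have [K KC /andP[uK vK]] := coverC u v euv.
  apply: proper_card; apply/properP; split.
    apply/subsetP=> K'; rewrite !inE => /andP[-> sK'] /=.
    exact: subset_trans sK' (subsetUr _ _).
  exists K; rewrite inE KC /=; last by apply/negP=> /subsetP/(_ v vK); apply/negP.
  (* A white member [w] of the clique [K] is a neighbour of [u], hence equals [v]. *)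
  apply/subsetP=> w wK; rewrite !inE; have [|/= wS] := boolP (w \in S).
    by rewrite orbT.
  rewrite orbF; have /implyP := uv w; apply; rewrite wS andbT.
  by apply: (cliqueC K) => //; apply: contraNneq wS => <-.
have : #|full setT| <= #|C|.
  by apply/subset_leq_card/subsetP=> K; rewrite inE => /andP[].
rewrite cardsT => leC /(leq_trans (leq_addr _ _)) leT.
by apply: leq_trans leT _; rewrite leq_add2l.
Qed.

End LeakyForcing.

(** * Coordinates and unit moves in the triangular grid *)

Definition coord n (v : supertriangle n) (i : 'I_3) : nat := val v i.

(** Supplies the third index, so that later arguments treat all pairs of distinct coordinates
    uniformly. *)
Lemma ord3_third (i j : 'I_3) : i != j ->
  exists k, [/\ k != i, k != j & forall l, [\/ l = i, l = j | l = k]].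
Proof.
have o3 (l : 'I_3) : [\/ l = inord 0, l = inord 1 | l = inord 2].
  case: l => [[|[|[|//]]] l3]; [constructor 1|constructor 2|constructor 3];
  by apply: val_inj; rewrite /= inordK.
by case: (o3 i) => ->; case: (o3 j) => ->; rewrite -?val_eqE /= ?inordK // => _;
  [exists (inord 2)|exists (inord 1)|exists (inord 2)
  |exists (inord 0)|exists (inord 1)|exists (inord 0)];
  (split; [by rewrite -val_eqE /= ?inordK|by rewrite -val_eqE /= ?inordK|]);
  move=> l; case: (o3 l) => ->; by [constructor 1|constructor 2|constructor 3].
Qed.

Lemma sum_ord3 (f : 'I_3 -> nat) (i j k : 'I_3) :
  i != j -> k != i -> k != j -> \sum_l f l = f i + f j + f k.
Proof.
move=> ij ki kj; rewrite (bigD1 i) //= (bigD1 j) //= 1?eq_sym //.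
rewrite (bigD1 k) /=; last by rewrite ki kj.
rewrite big1 ?addn0 ?addnA // => l /andP[/andP[li lj] lk].
have [k' [ki' kj' all3]] := ord3_third ij.
have ek : k = k' by case: (all3 k) ki kj => // ->; rewrite eqxx.
by case: (all3 l) li lj lk => ->; rewrite ?ek eqxx.
Qed.

Section Supertriangle.

Variable n : nat.
Implicit Types (B S : {set supertriangle n}) (v w x y : supertriangle n) (i j k : 'I_3).
Implicit Types (J : {set 'I_3}).
Local Notation adj := (@supertriangle_adj n).

Lemma coord_inj v w : coord v =1 coord w -> v = w.
Proof. by move=> eqvw; apply/val_inj/ffunP=> i; apply/val_inj/eqvw. Qed.

Lemma coord_sum v : \sum_i coord v i = n.-1.
Proof. exact/eqP/(valP v). Qed.

Lemma coord_sum3 v i j k : i != j -> k != i -> k != j ->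
  coord v i + coord v j + coord v k = n.-1.
Proof. by move=> *; rewrite -(coord_sum v) (@sum_ord3 _ i j k). Qed.

Lemma exists_coord (f : 'I_3 -> nat) : 0 < n -> \sum_i f i = n.-1 ->
  exists v, coord v =1 f.
Proof.
move=> n_gt0 sumf.
have f_lt i : f i < n by rewrite -(ltn_predK n_gt0) ltnS -sumf (bigD1 i) // leq_addr.
pose g : {ffun 'I_3 -> 'I_n} := [ffun i => Ordinal (f_lt i)].
have sumg : \sum_(i < 3) g i == n.-1.
  by rewrite -sumf; apply/eqP/eq_bigr => i _; rewrite ffunE.
by exists (exist (fun g : {ffun 'I_3 -> 'I_n} => \sum_(i < 3) g i == n.-1) g sumg) => i;
  rewrite /coord /= ffunE.
Qed.

(* y = x + e_i - e_j *)
Definition moved i j x y :=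
  [&& coord y i == (coord x i).+1, (coord y j).+1 == coord x j &
      [forall k, (k != i) && (k != j) ==> (coord y k == coord x k)]].

Lemma supertriangle_adjP x y :
  reflect (exists2 ij, ij.1 != ij.2 & moved ij.1 ij.2 x y) (adj x y).
Proof.
apply: (iffP existsP) => [[i /existsP[j /and4P[ij yi yj yk]]]|].
  by exists (i, j) => //; apply/and3P.
by case=> [[i j] /= ij /and3P[yi yj yk]]; exists i; apply/existsP; exists j; apply/and4P.
Qed.

Lemma movedP i j k x y : i != j -> k != i -> k != j ->
  reflect [/\ coord y i = (coord x i).+1, (coord y j).+1 = coord x j
            & coord y k = coord x k] (moved i j x y).
Proof.
move=> ij ki kj; apply: (iffP and3P) => [[/eqP yi /eqP yj /forallP/(_ k)]|].
  by rewrite ki kj => /eqP.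
case=> yi yj yk; rewrite yi yj !eqxx; split=> //; apply/forallP=> l.
apply/implyP=> /andP[li lj]; suff -> : l = k by rewrite yk.
have [k' [_ _ all3]] := ord3_third ij.
case: (all3 k) ki kj => [->|->|->]; rewrite ?eqxx // => _ _.
by case: (all3 l) li lj => ->; rewrite ?eqxx.
Qed.

Lemma moved_exists i j x : 0 < n -> i != j -> 0 < coord x j ->
  exists y, moved i j x y.
Proof.
move=> n_gt0 ij xj; have [k [ki kj all3]] := ord3_third ij.
pose f l := if l == i then (coord x i).+1 else
            if l == j then (coord x j).-1 else coord x l.
have [fi fj fk] : [/\ f i = (coord x i).+1, f j = (coord x j).-1 & f k = coord x k].
  by rewrite /f eqxx (negPf ki) (negPf kj) eq_sym (negPf ij) eqxx.
have [|y yf] := @exists_coord f n_gt0.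
  rewrite (sum_ord3 _ ij ki kj) fi fj fk -(coord_sum3 x ij ki kj); lia.
by exists y; apply/(movedP _ _ ij ki kj); rewrite !yf fi fj fk; split=> //; lia.
Qed.

Lemma moved_inj i j x y y' : i != j -> moved i j x y -> moved i j x y' -> y = y'.
Proof.
move=> ij; have [k [ki kj all3]] := ord3_third ij.
move=> /(movedP _ _ ij ki kj)[yi yj yk] /(movedP _ _ ij ki kj)[yi' yj' yk'].
by apply: coord_inj => l; case: (all3 l) => ->; lia.
Qed.

(** A move raises one coordinate and lowers one, so a single strict inequality identifies either
    index. *)
Lemma moved_gt i j k x y : moved i j x y -> coord x k < coord y k -> k = i.
Proof.
case/and3P=> _ /eqP yj /forallP/(_ k) yk; apply: contraTeq => ki.
move: yk; rewrite ki; have [->|_] := eqVneq k j; first by lia.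
by move/eqP=> ->; rewrite ltnn.
Qed.

Lemma moved_lt i j k x y : moved i j x y -> coord y k < coord x k -> k = j.
Proof.
case/and3P=> /eqP yi _ /forallP/(_ k) yk; apply: contraTeq => kj.
move: yk; rewrite kj andbT; have [->|_] := eqVneq k i; first by lia.
by move/eqP=> ->; rewrite ltnn.
Qed.

(** * Sides and the sizes of their unions *)

Definition side i : {set supertriangle n} := [set v | coord v i == 0].

Lemma card_side i : 0 < n -> #|side i| = n.
Proof.
move=> n_gt0; have [j ij] : exists j, i != j.
  by exists (ordS i); case: i => [[|[|[|//]]] i3]; rewrite -val_eqE.
have [k [ki kj all3]] := ord3_third ij.
(* Coordinate [j] maps the side bijectively onto ['I_n]. *)
rewrite -[RHS]card_ord -cardsT -(@card_in_imset _ _ (fun v => val v j) (mem (side i))).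
  congr #|pred_of_set _|; apply/setP=> a; rewrite in_setT; apply/imsetP.
  pose f l := if l == i then 0 else if l == j then nat_of_ord a else n.-1 - a.
  have [fi fj fk] : [/\ f i = 0, f j = nat_of_ord a & f k = n.-1 - a].
    by rewrite /f eqxx (negPf ki) (negPf kj) eq_sym (negPf ij) eqxx.
  have [|v vf] := @exists_coord f n_gt0.
    by rewrite (sum_ord3 _ ij ki kj) fi fj fk; have := ltn_ord a; lia.
  exists v; first by rewrite inE vf fi.
  by apply: val_inj; rewrite -[LHS]fj -vf.
move=> v w; rewrite !inE => /eqP vi /eqP wi /(congr1 val) vwj.
have {}vwj : coord v j = coord w j by [].
have := coord_sum3 v ij ki kj; have := coord_sum3 w ij ki kj => sw sv.
by apply: coord_inj => l; case: (all3 l) => ->; lia.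
Qed.

Lemma card_corner i j : 0 < n -> i != j -> #|side i :&: side j| = 1.
Proof.
move=> n_gt0 ij; have [k [ki kj all3]] := ord3_third ij.
pose f l := if l == k then n.-1 else 0.
have [fi fj fk] : [/\ f i = 0, f j = 0 & f k = n.-1].
  by rewrite /f eqxx eq_sym (negPf ki) eq_sym (negPf kj).
have [|v vf] := @exists_coord f n_gt0.
  by rewrite (sum_ord3 _ ij ki kj) fi fj fk.
apply/eqP/cards1P; exists v; apply/setP=> w; rewrite !inE.
apply/andP/eqP=> [[/eqP wi /eqP wj]|->]; last by rewrite !vf fi fj.
have := coord_sum3 w ij ki kj; have := coord_sum3 v ij ki kj => sv sw.
have [vi vj] : coord v i = 0 /\ coord v j = 0 by rewrite !vf.
by apply: coord_inj => l; case: (all3 l) => ->; lia.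
Qed.

Lemma card_two_sides i j : 0 < n -> i != j -> #|side i :|: side j| = 2 * n - 1.
Proof. by move=> n_gt0 ij; rewrite cardsU card_corner // !card_side //; lia. Qed.

Lemma card_three_sides i j k : 1 < n -> i != j -> k != i -> k != j ->
  #|side i :|: side j :|: side k| = 3 * n - 3.
Proof.
move=> n_gt1 ij ki kj; have n_gt0 : 0 < n by lia.
rewrite cardsU card_two_sides // card_side // setIUl cardsU.
rewrite !card_corner 1?eq_sym //.
(* A vertex on all three sides would have coordinate sum 0, but [n.-1] is positive. *)
suff -> : side i :&: side k :&: (side j :&: side k) = set0 by rewrite cards0; lia.
apply/setP=> v; rewrite !inE; have := coord_sum3 v ij ki kj.
by apply: contra_eqF => /andP[/andP[/eqP-> /eqP->] /andP[/eqP-> _]]; lia.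
Qed.

(** * Directions of moves and degrees on the boundary *)

(** The pair [(i, j)] encodes the direction e_i - e_j, which lowers coordinate [j]. *)
Definition moves J : {set 'I_3 * 'I_3} := [set ij | (ij.1 != ij.2) && (ij.2 \in J)].

Lemma card_moves J : #|moves J| = 2 * #|J|.
Proof.
rewrite -sum1_card mulnC -sum_nat_const.
rewrite (eq_bigr (fun j => \sum_(i | i != j) 1)); last first.
  by move=> j _; rewrite sum1_card cardC1 card_ord.
rewrite (exchange_big_dep predT) //= pair_big_dep /=.
by apply: eq_bigl => [[i j]]; rewrite inE /= andbC.
Qed.

(** A zero coordinate cannot be lowered, which leaves four directions out of [v], each leading to at
    most one neighbour. *)
Lemma degree_side i v : coord v i = 0 -> #|[set u | adj u v]| <= 4.
Proof.
move=> vi.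
have [ij ijP] : exists ij : supertriangle n -> 'I_3 * 'I_3,
    forall u, adj u v -> ij u \in moves (~: [set i]) /\ moved (ij u).1 (ij u).2 v u.
  apply: (@fin_all_exists _ (fun=> _)
    (fun u ij => adj u v -> ij \in moves _ /\ moved ij.1 ij.2 v u)) => u.
  rewrite supertriangle_adj_sym; case: supertriangle_adjP => [[ij ijN vu]|_].
    exists ij => _; split=> //; rewrite !inE ijN; apply/eqP=> eji.
    by case/and3P: vu; rewrite eji vi.
  (* Default value for vertices not adjacent to [v]. *)
  by exists (i, i).
have <- : #|moves (~: [set i])| = 4.
  by rewrite card_moves cardsC1 card_ord.
rewrite -(card_in_imset (f := ij)).
  apply/subset_leq_card/subsetP=> _ /imsetP[u + ->].
  by rewrite inE => /ijP[].
move=> u w; rewrite !inE => /ijP[ijM vu] /ijP[_ vw] eij.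
move: ijM; rewrite inE => /andP[ijN _]; rewrite eij in vu ijN.
exact: moved_inj ijN vu vw.
Qed.

(** * Upward triangles and the lower bound *)

(* The upward triangle {t, t - e_0 + e_1, t - e_0 + e_2}. *)
Definition up_triangle (t : supertriangle n) : {set supertriangle n} :=
  [set v | [forall k, coord t k - (k == ord0) <= coord v k]].

(** Members dominate t - e_0, whose coordinate sum is one less than theirs, so each exceeds it by
    one in a single coordinate. *)
Lemma up_triangle_clique t x y : coord t ord0 != 0 ->
  x \in up_triangle t -> y \in up_triangle t -> x != y -> adj x y.
Proof.
rewrite !inE => t0 /forallP tx /forallP ty xy.
(* Since coordinate sums agree, neither of two distinct vertices dominates the other. *)
have lt_coord v w : v != w -> exists i, coord v i < coord w i.
  move=> vw; apply/existsP; apply: contraT; rewrite negb_exists => /forallP le_wv.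
  have [j [k [ij [ki kj all3]]]] : exists j k, ord0 != j /\ [/\ k != ord0, k != j &
      forall l, [\/ l = ord0, l = j | l = k]].
    by exists ord_max; have [k kP] := @ord3_third ord0 ord_max isT; exists k.
  have := coord_sum3 v ij ki kj; have := coord_sum3 w ij ki kj.
  have := le_wv ord0; have := le_wv j; have := le_wv k; rewrite -!leqNgt => *.
  case/eqP: vw; apply: coord_inj => l; case: (all3 l) => ->; lia.
have [i xyi] := lt_coord _ _ xy; have [|j yxj] := lt_coord y x.
  by rewrite eq_sym.
have ij : i != j by apply: contraTneq xyi => ->; lia.
have [k [ki kj all3]] := ord3_third ij.
apply/supertriangle_adjP; exists (i, j) => //; apply/(movedP _ _ ij ki kj).
have := coord_sum3 x ij ki kj; have := coord_sum3 y ij ki kj.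
have : \sum_k (coord t k - (k == ord0)) + 1 = n.-1.
  rewrite -(coord_sum t) (bigD1 ord0) //= [RHS](bigD1 ord0) //=.
  by rewrite (eq_bigr (coord t)) => [|l /negPf->]; rewrite ?subn0 //; lia.
rewrite (sum_ord3 _ ij ki kj).
move: (tx i) (tx j) (tx k) (ty i) (ty j) (ty k) => *; split; lia.
Qed.

Lemma up_triangle_cover x y : 0 < n -> adj x y ->
  exists2 t, coord t ord0 != 0 & (x \in up_triangle t) && (y \in up_triangle t).
Proof.
move=> n_gt0 /supertriangle_adjP[[i j] /= ij xy].
have [k [ki kj all3]] := ord3_third ij.
have /(movedP _ _ ij ki kj)[yi yj yk] := xy.
(* Both [x] and [y] dominate x - e_j, so [t] is taken to be x - e_j + e_0. *)
have [||t tf] := @exists_coord (fun l => coord x l - (l == j) + (l == ord0)) => //.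
  rewrite big_split /= (sum_ord3 _ ij ki kj) -(coord_sum3 x ij ki kj).
  rewrite eqxx (negPf ij) (negPf kj) (bigD1 ord0) //=.
  by rewrite big1 => [|l /negPf->//]; lia.
exists t; first by rewrite tf eqxx addn1.
rewrite !inE; apply/andP; split; apply/forallP=> l; rewrite tf addnK; first lia.
by case: (all3 l) => ->; rewrite ?eqxx; lia.
Qed.

(** Upward triangles are indexed by the vertices off [side ord0], so the clique cover has at least
    [n] fewer elements than there are vertices. *)
Lemma leaky_forcing_ge_side l B : 0 < n -> leaky_forcing adj l B -> n <= #|B|.
Proof.
move=> n_gt0 forceB; pose C := [set up_triangle t | t in ~: side ord0].
suff : #|supertriangle n| <= #|B| + #|C|.
  have := leq_imset_card up_triangle (~: side ord0).
  have := cardsC (side ord0); rewrite card_side // -/C; lia.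
apply: leaky_forcing_clique_cover forceB => [K u v /imsetP[t]|u v].
  by rewrite 2!inE => t0 ->; apply: up_triangle_clique.
move=> /(up_triangle_cover n_gt0)[t t0 uvt]; exists (up_triangle t) => //.
by apply: imset_f; rewrite !inE.
Qed.

(** * Extremal white vertices and unions of sides as forcing sets *)

(** The conclusions beyond readiness make the pair [(i, j)] recoverable from [u], which later shows
    that distinct pairs give distinct vertices. *)
Lemma extremal_ready S i j : 0 < n -> i != j -> S != setT ->
    (forall v, coord v j = 0 -> v \in S) ->
  exists u, [/\ u \in ready adj S,
    exists2 w, w \notin S & moved i j w u,
    forall w, w \notin S -> coord w i < coord u i &
    forall w, w \notin S -> coord u i = (coord w i).+1 -> coord u j < coord w j].
Proof.
move=> n_gt0 ij SnT Sj; have [k [ki kj all3]] := ord3_third ij.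
have /properP[_ [w0 _ w0S]] : S \proper setT by rewrite properT.
(* [w1] gives the maximal value of coordinate [i] on white vertices; [w] minimises coordinate [j]
   among those attaining it. *)
have [w1 w1S max_w1] := arg_maxnP (P := fun w => w \notin S) (fun w => coord w i) w0S.
have [|w /andP[wS /eqP wi] min_w] :=
    @arg_minnP _ w1 (fun w => (w \notin S) && (coord w i == coord w1 i))
      (fun w => coord w j).
  by rewrite w1S /=.
have wj : 0 < coord w j by rewrite lt0n; apply: contra wS => /eqP/Sj.
have [u wu] := moved_exists n_gt0 ij wj.
have /(movedP _ _ ij ki kj)[ui uj uk] := wu.
have max_u v : v \notin S -> coord v i < coord u i.
  by move=> /max_w1 /=; rewrite ui wi ltnS.
have min_u v : v \notin S -> coord u i = (coord v i).+1 -> coord u j < coord v j.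
  move=> vS eiv; rewrite uj; apply: min_w; rewrite vS /=; lia.
exists u; split=> //; last by exists w.
rewrite inE; apply/andP; split; first by apply: contraT => /max_u; rewrite ltnn.
apply/existsP; exists w; apply/and3P; split=> //.
  by rewrite supertriangle_adj_sym; apply/supertriangle_adjP; exists (i, j).
(* Going from [u] to a white neighbour [v] must lower coordinate [i] and raise coordinate [j], which
   undoes the move from [w] to [u]. *)
apply/forallP=> v; apply/implyP=> /andP[uv vS].
have [[p q] /= _ pq] := supertriangle_adjP _ _ uv.
have eqi := moved_lt pq (max_u v vS); rewrite -eqi in pq.
have uiv : coord u i = (coord v i).+1 by case/and3P: pq => _ /eqP.
have eqj := moved_gt pq (min_u v vS uiv); rewrite -eqj in pq.
have /(movedP _ _ _ kj ki)[|vj vi vk] := pq; first by rewrite eq_sym.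
by apply/eqP/coord_inj => l; case: (all3 l) => ->; lia.
Qed.

(** The extremal vertices embed [moves J] into [ready S], which therefore has at least [2 * #|J|]
    elements. *)
Lemma leaky_forcing_sides l J B : 0 < n -> l < 2 * #|J| ->
  (forall j, j \in J -> side j \subset B) -> leaky_forcing adj l B.
Proof.
move=> n_gt0 lJ sJB; apply: leaky_forcing_ready => S sBS SnT.
apply: (leq_trans lJ); rewrite -card_moves.
have [f fP] : exists f : 'I_3 * 'I_3 -> supertriangle n,
    forall ij, ij \in moves J -> [/\ f ij \in ready adj S,
    exists2 w, w \notin S & moved ij.1 ij.2 w (f ij),
    forall w, w \notin S -> coord w ij.1 < coord (f ij) ij.1 &
    forall w, w \notin S -> coord (f ij) ij.1 = (coord w ij.1).+1 ->
      coord (f ij) ij.2 < coord w ij.2].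
  apply: (@fin_all_exists _ (fun=> _) (fun ij u => ij \in moves J -> [/\ u \in _,
    exists2 w, w \notin S & moved ij.1 ij.2 w u,
    forall w, w \notin S -> coord w ij.1 < coord u ij.1 &
    forall w, w \notin S -> coord u ij.1 = (coord w ij.1).+1 ->
      coord u ij.2 < coord w ij.2])) => [[i j]] /=.
  have [|_] := boolP ((i, j) \in moves J).
    rewrite inE /= => /andP[ij jJ].
    have [v vj|u uP] := extremal_ready n_gt0 ij SnT; last by exists u.
    by apply: (subsetP sBS); apply: (subsetP (sJB j jJ)); rewrite inE vj.
  (* Default value outside [moves J]: some white vertex. *)
  by have /properP[_ [v]] : S \proper setT; [rewrite properT | exists v].
rewrite -(card_in_imset (f := f)).
  by apply/subset_leq_card/subsetP=> _ /imsetP[ij /fP[? _ _ _] ->].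
(* The white vertex [w] behind the second pair is tested against the extremality for the first: the
   maximum gives [i = i'], then the minimum gives [j = j']. *)
move=> [i j] [i' j'] ijM ijM' eqf.
have [_ _ max_u min_u] := fP _ ijM; have [_ [w wS wu] _ _] := fP _ ijM'.
rewrite /= -eqf in max_u min_u wu.
have ei := moved_gt wu (max_u w wS); rewrite -ei in wu *.
have uiw : coord (f (i, j)) i = (coord w i).+1 by case/and3P: wu => /eqP.
by rewrite (moved_lt wu (min_u w wS uiw)).
Qed.

End Supertriangle.

Theorem theorem4p5 (n : nat) (n_gt0 : 0 < n) :
  [/\ Zleaky 0 n = n /\ Zleaky 1 n = n,
      Zleaky 2 n <= Zleaky 3 n <= 2 * n - 1 &
      1 < n -> Zleaky 4 n = 3 * n - 3 /\ Zleaky 5 n = 3 * n - 3].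
Proof.
have o01 : (ord0 : 'I_3) != ord_max by [].
have [k [k0 k1 all3]] := ord3_third o01.
have ge l : n <= Zleaky l n.
  have [[B forceB cardB] _] := leaky_forcing_numberP (@supertriangle_adj n) l.
  rewrite /Zleaky -cardB; exact: leaky_forcing_ge_side n_gt0 forceB.
have le l (J : {set 'I_3}) (B : {set supertriangle n}) : l < 2 * #|J| ->
    (forall j, j \in J -> side n j \subset B) -> Zleaky l n <= #|B|.
  move=> lJ sJB; have [_ minB] := leaky_forcing_numberP (@supertriangle_adj n) l.
  exact: minB (leaky_forcing_sides n_gt0 lJ sJB).
have le1 l : l <= 1 -> Zleaky l n = n.
  move=> l1; apply/eqP; rewrite eqn_leq ge andbT -[leqRHS](card_side ord0 n_gt0).
  by apply: (le l [set ord0]) => [|j]; rewrite ?cards1 // => /set1P->.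
split; first by split; apply: le1.
  rewrite leaky_forcing_number_le //= -(card_two_sides n_gt0 o01).
  apply: (le 3 [set ord0; ord_max]) => [|j]; rewrite ?cards2 // => /set2P[]->.
    exact: subsetUl.
  exact: subsetUr.
move=> n_gt1; rewrite -(card_three_sides n_gt1 o01 k0 k1).
set B := _ :|: _; have sB j : side n j \subset B.
  rewrite /B; case: (all3 j) => ->; last exact: subsetUr.
    by rewrite -setUA subsetUl.
  by rewrite setUAC subsetUr.
suff le45 l : 4 <= l <= 5 -> Zleaky l n = #|B| by split; apply: le45.
(* Upper bound: all three indices are taken, and [l <= 5] is below 2 * 3. *)
case/andP=> l4 l5; apply/eqP; rewrite eqn_leq (le l setT) ?cardsT ?card_ord //=.
have [[B' forceB' cardB] _] := leaky_forcing_numberP (@supertriangle_adj n) l.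
rewrite /Zleaky -cardB.
(* Lower bound: [l >= 4] leaks can occupy the whole neighbourhood of a boundary vertex. *)
have sB' j : side n j \subset B'.
  apply/subsetP=> v; rewrite inE => /eqP vj.
  by apply: leaky_forcing_low_degree forceB'; apply: leq_trans (degree_side vj) l4.
by apply/subset_leq_card; rewrite !subUset !sB'.
Qed.
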